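(* Let a topological group $G$ act continuously on a space $X$ such that $X/G$ is connected. Suppose every $x\in X$ is contained in a constant slice $(S,\mathrm{Stab}_x(G))$. Then the conjugacy class of $\Gamma:=\mathrm{Stab}_x(G)$ is independent of $x$, and the comparison map $X/\!\!/G\to X/G$ is a fibre bundle with fibre $B\Gamma$.
   Context: For an action $G\curvearrowright X$, a pair $(S,\Gamma)$ with $S\subseteq X$ a subspace and $\Gamma\le G$ a subgroup is a slice if: (SL1) $g\cdot S\subseteq S$ for all $g\in\Gamma$; (SL2) if $g\cdot S\cap S\neq\emptyset$ then $g\in\Gamma$; (SL3) $G\to G/\Gamma$ is a principal $\Gamma$-bundle and there is a local section $\chi\colon U\to G$ defined on a neighbourhood $U$ of the identity coset such that $U\times S\to X$, $([u],s)\mapsto\chi([u])\cdot s$, is an open embedding. A slice is constant if $\Gamma$ acts trivially on $S$. $\mathrm{Stab}_x(G)=\{g\in G: g x=x\}$. The homotopy quotient is $X/\!\!/G:=(EG\times X)/G$ with diagonal action ($EG\to BG$ the universal principal $G$-bundle), and the comparison map $X/\!\!/G\to X/G$ is induced by projection to $X$. *)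

(* Defs.v *)
From HB Require Import structures.
From mathcomp Require Import all_boot all_order all_algebra.
From mathcomp Require Import all_classical all_reals all_analysis.
From mathcomp Require Import Rstruct Rstruct_topology.
Set Implicit Arguments. Unset Strict Implicit. Unset Printing Implicit Defensive.
Local Open Scope classical_set_scope.

Definition homeo_on {T1 T2 : topologicalType} (A : set T1) (B : set T2)
  (f : T1 -> T2) : Prop :=
  exists g : T2 -> T1,
    [/\ (forall a, A a -> B (f a)), (forall b, B b -> A (g b)),
        (forall a, A a -> g (f a) = a), (forall b, B b -> f (g b) = b) &
        ({within A, continuous f} /\ {within B, continuous g})].

Definition open_embedding_on {T1 T2 : topologicalType} (A : set T1)
  (f : T1 -> T2) : Prop :=
  open (f @` A) /\ homeo_on A (f @` A) f.

Definition topological_group {G : topologicalType} (mul : G -> G -> G)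
  (inv : G -> G) (one : G) : Prop :=
  [/\ (forall a b c, mul a (mul b c) = mul (mul a b) c),
      (forall a, mul one a = a /\ mul a one = a),
      (forall a, mul (inv a) a = one /\ mul a (inv a) = one),
      continuous (fun p : G * G => mul p.1 p.2) & continuous inv].

Definition continuous_action {G X : topologicalType} (mul : G -> G -> G)
  (one : G) (act : G -> X -> X) : Prop :=
  [/\ (forall x, act one x = x),
      (forall g h x, act (mul g h) x = act g (act h x)) &
      continuous (fun p : G * X => act p.1 p.2)].

Definition orbit_space {G X Q : topologicalType} (act : G -> X -> X)
  (q : X -> Q) : Prop :=
  [/\ (forall y, exists x, q x = y),
      (forall x y, q x = q y <-> exists g, act g x = y) &
      (forall U : set Q, open U <-> open (q @^-1` U))].

Definition Stab {G X : Type} (act : G -> X -> X) (x : X) : set G :=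
  [set g | act g x = x].

(* p : E -> B is a principal H-bundle for the action act (H a subgroup of
   the ambient group, carrying the subspace topology): p is continuous,
   H-invariant, and locally trivial, i.e. every b has an open nbhd U with a
   local section s such that U x H -> p^-1 U, (u,h) |-> h.s(u) is a
   homeomorphism. *)
Definition principal_bundle {Gt E B : topologicalType} (H : set Gt)
  (act : Gt -> E -> E) (p : E -> B) : Prop :=
  [/\ continuous p,
      (forall h e, H h -> p (act h e) = p e) &
      (forall b, exists (U : set B) (s : B -> E),
         [/\ open U, U b, {within U, continuous s},
             (forall u, U u -> p (s u) = u) &
             homeo_on (U `*` H) (p @^-1` U)
                      (fun uh : B * Gt => act uh.2 (s uh.1))])].

Definition contractible (T : topologicalType) : Prop :=
  exists (x0 : T) (h : T * Rdefinitions.R -> T),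
    [/\ {within [set: T] `*` `[0%R, 1%R], continuous h},
        (forall x, h (x, 0%R) = x) & (forall x, h (x, 1%R) = x0)].

Definition classifying_space {G : topologicalType} (mul : G -> G -> G)
  (one : G) (Gam : set G) (F : topologicalType) : Prop :=
  exists (E : topologicalType) (a : G -> E -> E) (p : E -> F),
    [/\ (forall e, a one e = e),
        (forall g h e, Gam g -> Gam h -> a (mul g h) e = a g (a h e)),
        {within Gam `*` [set: E], continuous (fun ge : G * E => a ge.1 ge.2)},
        principal_bundle Gam a p & contractible E].

Definition fibre_bundle {Y B : topologicalType} (c : Y -> B)
  (F : topologicalType) : Prop :=
  continuous c /\
  forall b, exists (U : set B) (phi : Y -> B * F),
    [/\ open U, U b,
        homeo_on (c @^-1` U) (U `*` [set: F]) phi &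
        (forall y, U (c y) -> (phi y).1 = c y)].

(* (S, Gam) is a slice for the action act of G on X (conditions SL1-SL3);
   G/Gam is presented by a quotient map pi : G -> P onto right cosets. *)
Definition slice {G X : topologicalType} (mul : G -> G -> G) (one : G)
  (act : G -> X -> X) (S : set X) (Gam : set G) : Prop :=
  [/\ (forall g s, Gam g -> S s -> S (act g s)),
      (forall g, (exists s, S s /\ S (act g s)) -> Gam g) &
      exists (P : topologicalType) (pi : G -> P),
        [/\ (forall y, exists g, pi g = y),
            (forall g h, pi g = pi h <-> exists k, Gam k /\ h = mul g k),
            (forall U : set P, open U <-> open (pi @^-1` U)),
            principal_bundle Gam (fun k g => mul g k) pi &
            exists (U : set P) (chi : P -> G),
              [/\ open U, U (pi one), {within U, continuous chi},
                  (forall u, U u -> pi (chi u) = u) &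
                  open_embedding_on (U `*` S)
                    (fun us : P * X => act (chi us.1) us.2)]]].

Definition constant_slice {G X : topologicalType} (mul : G -> G -> G)
  (one : G) (act : G -> X -> X) (S : set X) (Gam : set G) : Prop :=
  slice mul one act S Gam /\ (forall g s, Gam g -> S s -> act g s = s).

(* Main.v *)
Require Import Defs.
From HB Require Import structures.
From mathcomp Require Import all_boot all_order all_algebra.
From mathcomp Require Import all_classical all_reals all_analysis.

(** Over the image W of a constant slice, the slice is a local section sigma of
    q : X -> X/G along which the stabilizer is constantly Gam; W is open, so the
    conjugacy class of the stabilizer is locally constant on the connected space
    X/G.  Every point over W is g sigma(b) with g unique up to Gam and locally
    choosable continuously, whence (EG x X)/G is W x EG/Gam over W.  Finally
    EG -> EG/Gam is a principal Gam-bundle with contractible total space, so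
    EG/Gam is a BGam. *)

Set Implicit Arguments. Unset Strict Implicit. Unset Printing Implicit Defensive.
Local Open Scope classical_set_scope.

(** * Continuity at points and on open sets *)

Lemma within_open_continuousP (T U : topologicalType) (A : set T) (f : T -> U) :
  open A ->
  {within A, continuous f} <-> forall x, A x -> {for x, continuous f}.
Proof.
move=> oA; rewrite continuous_open_subspace //; split=> cf x.
  by move=> Ax; apply: cf; rewrite inE.
by rewrite inE => Ax; exact: cf.
Qed.

Lemma near_eq_continuous (T U : topologicalType) (f g : T -> U) (x : T) :
  (\forall y \near x, f y = g y) -> {for x, continuous f} ->
  {for x, continuous g}.
Proof.
move=> fg cf; rewrite /prop_for /continuous_at -(nbhs_singleton fg).
by apply: cvg_trans cf; exact: near_eq_cvg.
Qed.

Lemma open_preimage_near (T U : topologicalType) (f : T -> U) (A : set U) x :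
  {for x, continuous f} -> open A -> A (f x) -> \forall y \near x, A (f y).
Proof. by move=> cf oA Ax; apply: cf; exact: open_nbhs_nbhs. Qed.

Lemma open_preimage_on (T U : topologicalType) (W : set T) (f : T -> U)
    (A : set U) :
  open W -> (forall x, W x -> {for x, continuous f}) -> open A ->
  open (W `&` f @^-1` A).
Proof.
move=> oW cf oA; rewrite openE => x [Wx Ax].
apply: filterI; first exact: open_nbhs_nbhs.
exact: open_preimage_near (cf x Wx) oA Ax.
Qed.

Lemma continuous_at_pair (T U V : topologicalType) (f : T -> U) (g : T -> V) x :
  {for x, continuous f} -> {for x, continuous g} ->
  {for x, continuous (fun y => (f y, g y))}.
Proof. by move=> cf cg; exact: cvg_pair. Qed.

Lemma continuous_at_comp (T U V : topologicalType) (f : T -> U) (g : U -> V) x :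
  {for x, continuous f} -> {for f x, continuous g} ->
  {for x, continuous (fun y => g (f y))}.
Proof. by move=> cf cg; exact: (continuous_comp cf cg). Qed.

Lemma continuous_at2 (T U V Z : topologicalType) (op : U -> V -> Z)
    (f : T -> U) (g : T -> V) x :
  continuous (fun p : U * V => op p.1 p.2) ->
  {for x, continuous f} -> {for x, continuous g} ->
  {for x, continuous (fun y => op (f y) (g y))}.
Proof.
move=> cop cf cg.
exact: (continuous_at_comp (continuous_at_pair cf cg) (cop _)).
Qed.

Lemma continuous_at_fst (T U V : topologicalType) (f : T -> U * V) x :
  {for x, continuous f} -> {for x, continuous (fun y => (f y).1)}.
Proof. by move=> cf; apply: continuous_at_comp cf _; exact: cvg_fst. Qed.

Lemma continuous_at_snd (T U V : topologicalType) (f : T -> U * V) x :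
  {for x, continuous f} -> {for x, continuous (fun y => (f y).2)}.
Proof. by move=> cf; apply: continuous_at_comp cf _; exact: cvg_snd. Qed.

Lemma open_setXT (T U : topologicalType) (A : set T) :
  open A -> open (A `*` [set: U]).
Proof.
move=> oA; have -> : A `*` [set: U] = fst @^-1` A.
  by apply/seteqP; split=> x; [case|].
by apply: open_comp => // x _; exact: cvg_fst.
Qed.

(** * Quotient maps *)

Definition quotient_map {E F : topologicalType} (p : E -> F) : Prop :=
  (forall y, exists x, p x = y) /\
  (forall U : set F, open U <-> open (p @^-1` U)).

Lemma quotient_map_continuous (E F : topologicalType) (p : E -> F) :
  quotient_map p -> continuous p.
Proof. by move=> [_ qo]; apply/continuousP => A /qo. Qed.

(** The set [W] ∩ f^-1(O) has open preimage under [p], hence is open. This yields continuity of maps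
    that are defined on a quotient through arbitrary representatives. *)
Lemma quotient_map_descent (E F T : topologicalType) (p : E -> F) (f : F -> T)
    (W : set F) :
  quotient_map p -> open W ->
  (forall e, W (p e) -> {for e, continuous (fun e => f (p e))}) ->
  forall b, W b -> {for b, continuous f}.
Proof.
move=> [_ po] oW cf b Wb N /=; rewrite nbhsE; case=> O [oO Ofb] ON.
apply: (@filterS _ _ _ (W `&` f @^-1` O)); first by move=> z [_ /ON].
apply: open_nbhs_nbhs; split=> //; apply/po.
have oW' : open (p @^-1` W) by apply/po.
exact: (open_preimage_on oW' cf oO).
Qed.

(** Used to construct EG/Gam, where Gam is only a subset of [G]. *)
Lemma quotient_by_equivalence (E : topologicalType) (R : E -> E -> Prop) :
  (forall x, R x x) -> (forall x y, R x y -> R y x) ->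
  (forall x y z, R x y -> R y z -> R x z) ->
  exists (F : topologicalType) (p : E -> F),
    quotient_map p /\ forall x y, p x = p y <-> R x y.
Proof.
move=> Rr Rs Rt.
pose e := fun x y : E => `[< R x y >].
have er : reflexive e by move=> x; apply/asboolP.
have es : symmetric e.
  by move=> x y; apply/asboolP/asboolP; exact: Rs.
have et : transitive e.
  by move=> y x z /asboolP xy /asboolP yz; apply/asboolP; exact: Rt yz.
pose eR := EquivRel e er es et.
pose F := quotient_topology {eq_quot eR}%qT.
exists F, (\pi_F : E -> F)%qT; split.
  split=> // y; exists (repr y); exact: reprK.
move=> x y; split.
  by move/eqmodP => /asboolP.
by move=> xy; apply/eqmodP/asboolP.
Qed.


(** * Topological groups and continuous actions *)

Section GroupActions.
Context {G : topologicalType} {mul : G -> G -> G} {inv : G -> G} {one : G}.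
Hypothesis TG : topological_group mul inv one.

Lemma group_mulA a b d : mul a (mul b d) = mul (mul a b) d.
Proof. by case: TG. Qed.

Lemma group_mul1g a : mul one a = a.
Proof. by case: TG => _ /(_ a) []. Qed.

Lemma group_mulg1 a : mul a one = a.
Proof. by case: TG => _ /(_ a) []. Qed.

Lemma group_mulVg a : mul (inv a) a = one.
Proof. by case: TG => _ _ /(_ a) []. Qed.

Lemma group_mulgV a : mul a (inv a) = one.
Proof. by case: TG => _ _ /(_ a) []. Qed.

Lemma group_mulKg a b : mul (inv a) (mul a b) = b.
Proof. by rewrite group_mulA group_mulVg group_mul1g. Qed.

Lemma group_mulVKg a b : mul a (mul (inv a) b) = b.
Proof. by rewrite group_mulA group_mulgV group_mul1g. Qed.

Lemma group_inv_unique a b : mul a b = one -> b = inv a.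
Proof. by move=> ab; rewrite -(group_mulKg a b) ab group_mulg1. Qed.

Lemma group_invM a b : inv (mul a b) = mul (inv b) (inv a).
Proof.
apply/esym/group_inv_unique.
by rewrite -group_mulA group_mulVKg group_mulgV.
Qed.

Lemma group_mul_continuous : continuous (fun p : G * G => mul p.1 p.2).
Proof. by case: TG. Qed.

Lemma group_inv_continuous : continuous inv.
Proof. by case: TG. Qed.

Section OneAction.
Context {X : topologicalType} {act : G -> X -> X}.
Hypothesis CA : continuous_action mul one act.

Lemma action1 x : act one x = x.
Proof. by case: CA. Qed.

Lemma actionM g h x : act (mul g h) x = act g (act h x).
Proof. by case: CA. Qed.

Lemma action_continuous : continuous (fun p : G * X => act p.1 p.2).
Proof. by case: CA. Qed.

Lemma actionK g x : act (inv g) (act g x) = x.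
Proof. by rewrite -actionM group_mulVg action1. Qed.

Lemma actionVK g x : act g (act (inv g) x) = x.
Proof. by rewrite -actionM group_mulgV action1. Qed.

Lemma action_at (g : G) (x : X) : {for x, continuous (act g)}.
Proof.
apply: (@continuous_at2 _ _ _ _ act (fun=> g) id); first exact: action_continuous.
  exact: cvg_cst.
exact: cvg_id.
Qed.

Lemma Stab_one x : Stab act x one.
Proof. exact: action1. Qed.

Lemma Stab_mul x g h : Stab act x g -> Stab act x h -> Stab act x (mul g h).
Proof. by rewrite /Stab /= actionM => gx ->. Qed.

Lemma Stab_inv x g : Stab act x g -> Stab act x (inv g).
Proof. by rewrite /Stab /= => gx; rewrite -{1}gx actionK. Qed.

Lemma Stab_act g x :
  Stab act (act g x) = [set mul (mul g h) (inv g) | h in Stab act x].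
Proof.
apply/seteqP; split=> [k kx|k [h hx <-]]; last first.
  by rewrite /Stab /= !actionM actionK hx.
exists (mul (inv g) (mul k g)).
  by rewrite /Stab /= !actionM kx actionK.
by rewrite group_mulVKg -group_mulA group_mulgV group_mulg1.
Qed.

(** * Orbit maps and constant slices *)

Context {Q : topologicalType} {q : X -> Q}.
Hypothesis OS : orbit_space act q.

Lemma orbit_quotient_map : quotient_map q.
Proof. by case: OS. Qed.

Lemma orbit_eqP x y : q x = q y <-> exists g, act g x = y.
Proof. by case: OS. Qed.

Lemma orbit_map_act g x : q (act g x) = q x.
Proof. by apply/esym/orbit_eqP; exists g. Qed.

(** The saturation of [V] is the union of its translates, each of which is open. *)
Lemma orbit_map_open (V : set X) : open V -> open (q @` V).
Proof.
move=> oV; apply/(orbit_quotient_map.2 _).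
have -> : q @^-1` (q @` V) = \bigcup_g (act g @^-1` V).
  apply/seteqP; split=> [x [y Vy /esym/orbit_eqP [g gx]]|x [g _ Vx]].
    by exists g => //=; rewrite gx.
  by exists (act g x) => //; exact: orbit_map_act.
apply: bigcup_open => g _; apply: open_comp => // x _; exact: action_at.
Qed.

(* SL2 together with triviality of the action of Gam on S makes S meet each
   orbit in at most one point, so S -> q(S) is a bijection; the slice chart,
   moved around by G, shows that its inverse is continuous. *)
Lemma constant_slice_section (y : X) (S : set X) :
  S y -> constant_slice mul one act S (Stab act y) ->
  exists (W : set Q) (sigma : Q -> X),
    [/\ open W, W (q y),
        forall b, W b -> [/\ q (sigma b) = b, {for b, continuous sigma} &
                             Stab act (sigma b) = Stab act y] &
        forall x, W (q x) -> exists theta : X -> G,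
          {for x, continuous theta} /\
          \forall x' \near x, act (theta x') (sigma (q x')) = x'].
Proof.
move=> Sy [[SL1 SL2 [P [pi [pis piP _ _ [U [chi [oU U1 cchi piK emb]]]]]]] triv].
pose f := (fun us : P * X => act (chi us.1) us.2).
move: emb => [oV [h [_ hV hK fK [_ /(within_open_continuousP _ oV) ch]]]].
rewrite -/f in oV hV fK ch.
set V := f @` (U `*` S) in oV hV fK ch.
have chi_at u : U u -> {for u, continuous chi}.
  by move=> Uu; exact: (within_open_continuousP chi oU).1.
(* [chi (pi one)] lies in the coset of [one], so it fixes [S] pointwise, and [S] lies in the image
   [V] of the chart. *)
have chi1 : Stab act y (chi (pi one)).
  have /esym/piP [k [ky ->]] := piK _ U1.
  by rewrite group_mul1g.
have SV : S `<=` V.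
  by move=> s Ss; exists (pi one, s) => //=; rewrite /f /=; exact: triv.
have S_uniq s s' : S s -> S s' -> q s = q s' -> s = s'.
  move=> Ss Ss' /orbit_eqP [g gs].
  by rewrite -gs triv //; apply: SL2; exists s; rewrite gs.
have StabS s : S s -> Stab act s = Stab act y.
  move=> Ss; apply/seteqP; split=> g gs.
    by apply: SL2; exists s; split=> //; rewrite gs.
  exact: triv.
pose W := q @` S.
have WV x : W (q x) -> exists g, V (act g x).
  by move=> [s Ss /esym/orbit_eqP [g gx]]; exists g; rewrite gx; exact: SV.
have VW x : V x -> W (q x).
  by move=> [[u s] [_ /= Ss] <-]; exists s => //; rewrite orbit_map_act.
(* Over [W] the value is the unique point of [S] in the orbit; elsewhere [y] is a dummy value. *)
have /choice [sigma sigmaP] : forall b, exists s, W b -> S s /\ q s = b.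
  move=> b; have [[s Ss <-]|nW] := pselect (W b); first by exists s.
  by exists y.
(* [S] need not be open in [X], but [V] is, and both have the same image. *)
have WE : W = q @` V.
  apply/seteqP; split=> [_ [s Ss <-]|_ [x Vx <-]]; last exact: VW.
  by exists s => //; exact: SV.
have oW : open W by rewrite WE; exact: orbit_map_open.
have thetaP x : W (q x) -> exists theta : X -> G,
    {for x, continuous theta} /\
    \forall x' \near x, act (theta x') (sigma (q x')) = x'.
  move=> /WV [g Vgx].
  (* If (u, s) are the chart coordinates of g x', then s = sigma(q x') and x' = g^-1 chi(u) s. *)
  exists (fun x' => mul (inv g) (chi (h (act g x')).1)); split.
    apply: continuous_at2; [exact: group_mul_continuous|exact: cvg_cst|].
    apply: continuous_at_comp; last by apply: chi_at; case: (hV _ Vgx).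
    apply: continuous_at_fst; apply: continuous_at_comp; first exact: action_at.
    exact: ch.
  have := open_preimage_near (@action_at g x) oV Vgx.
  apply: filterS => x' Vgx'.
  case: (hV _ Vgx') => Uu Ss.
  have [Ssg qsg] : S (sigma (q x')) /\ q (sigma (q x')) = q x'.
    by apply: sigmaP; rewrite -(orbit_map_act g); exact: VW.
  have <- : (h (act g x')).2 = sigma (q x').
    apply: S_uniq => //; rewrite qsg -(orbit_map_act g x').
    by rewrite -{2}(fK _ Vgx') orbit_map_act.
  by rewrite actionM fK // actionK.
exists W, sigma; split=> //; first by exists y.
move=> b Wb; have [Ss qs] := sigmaP _ Wb; split=> //; last exact: StabS.
(* Near x, sigma(q x') = theta(x')^-1 x', which is continuous in x'. *)
apply: (quotient_map_descent orbit_quotient_map oW _ Wb) => x /thetaP.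
move=> [theta [ctheta near_theta]].
apply: (@near_eq_continuous _ _ (fun x' => act (inv (theta x')) x')).
  by move: near_theta; apply: filterS => x' e; rewrite -[X in act _ X]e actionK.
apply: continuous_at2; first exact: action_continuous.
  apply: continuous_at_comp; [exact: ctheta|exact: group_inv_continuous].
exact: cvg_id.
Qed.

End OneAction.

(** * Principal bundles for a subgroup *)

(** The map e ↦ t(e)^-1 e is H-invariant, so it descends to a section s with t(s(u)) = 1; then e ↦
    (p(e), t(e)) inverts (u, k) ↦ k s(u). *)
Lemma principal_bundle_of_equivariant (E F : topologicalType) (a : G -> E -> E)
    (p : E -> F) (H : set G) :
  continuous_action mul one a -> quotient_map p ->
  (forall e e', p e = p e' <-> exists2 k, H k & a k e = e') ->
  (forall k, H k -> H (inv k)) ->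
  (forall e0, exists (A : set E) (t : E -> G),
     [/\ open A, A e0, (forall k e, H k -> A e -> A (a k e)),
         (forall e, A e -> H (t e) /\ {for e, continuous t}) &
         (forall k e, H k -> A e -> t (a k e) = mul k (t e))]) ->
  principal_bundle H a p.
Proof.
move=> CA qp pP Hinv loc; split.
- exact: quotient_map_continuous.
- by move=> k e Hk; apply/esym/pP; exists k.
have /choice [rep repK] := proj1 qp.
move=> b; have [A [t [oA Ab aA tA ta]]] := loc (rep b).
(* [A] is saturated, so its image is open. *)
have prA : p @^-1` (p @` A) = A.
  apply/seteqP; split=> [e [e' Ae' /pP [k Hk <-]]|e Ae]; first exact: aA.
  by exists e.
have oU : open (p @` A) by apply/(qp.2 _); rewrite prA.
pose s u := a (inv (t (rep u))) (rep u).
have sE e : A e -> s (p e) = a (inv (t e)) e.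
  move=> Ae; rewrite /s.
  have /esym/pP [k Hk <-] := repK (p e).
  by rewrite ta // group_invM (actionM CA) (actionK CA).
have sA e : A e -> A (s (p e)).
  by move=> Ae; rewrite sE //; apply: aA => //; apply: Hinv; exact: (tA _ Ae).1.
have ps e : A e -> p (s (p e)) = p e.
  move=> Ae; rewrite sE //; apply/esym/pP; exists (inv (t e)) => //.
  by apply: Hinv; exact: (tA _ Ae).1.
have ts e : A e -> t (s (p e)) = one.
  move=> Ae; rewrite sE // ta ?group_mulVg //; apply: Hinv; exact: (tA _ Ae).1.
have cs u : (p @` A) u -> {for u, continuous s}.
  apply: (quotient_map_descent qp oU) => e pAe.
  have Ae : A e by rewrite -prA.
  apply: (@near_eq_continuous _ _ (fun e' => a (inv (t e')) e')).
    by apply: filterS (open_nbhs_nbhs (conj oA Ae)) => e' Ae'; rewrite sE.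
  apply: continuous_at2; first exact: (action_continuous CA).
    apply: continuous_at_comp; [exact: (tA _ Ae).2|exact: group_inv_continuous].
  exact: cvg_id.
exists (p @` A), s; split=> //.
- by exists (rep b).
- by apply/within_open_continuousP.
- by move=> _ [e Ae <-]; exact: ps.
exists (fun e => (p e, t e)); split.
- move=> [_ k] [/= [e Ae <-] Hk].
  by exists e => //; apply: (etrans (esym (ps e Ae))); apply/pP; exists k.
- move=> e; rewrite prA => Ae; split; first by exists e.
  exact: (tA _ Ae).1.
- move=> [_ k] [/= [e Ae <-] Hk]; congr (_, _).
    by apply: etrans (ps e Ae); apply/esym/pP; exists k.
  by rewrite ta ?ts ?group_mulg1 //; exact: sA.
- by move=> e; rewrite prA => Ae /=; rewrite sE // (actionVK CA).
split.
  (* [H] need not be open in [G], so continuity is checked on the larger open set p(A) x G. *)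
  apply: (@continuous_subspaceW _ _ _ ((p @` A) `*` setT)); first by move=> ? [].
  apply/within_open_continuousP; first exact: open_setXT.
  move=> [u k] [/= Uu _]; apply: (@continuous_at2 _ _ _ _ a snd (s \o fst)).
  - exact: (action_continuous CA).
  - exact: cvg_snd.
  - by apply: continuous_at_comp; [exact: cvg_fst|exact: cs].
rewrite prA; apply/within_open_continuousP => // e Ae.
apply: continuous_at_pair; last exact: (tA _ Ae).2.
exact: (quotient_map_continuous qp).
Qed.

(* Writing e = h e * s(u) in a local trivialization of E -> B, the map
   e |-> h e * sg(h(e)^-1 H), with sg a local section of G -> G/H, takes its
   values in H and is H-equivariant. *)
Lemma principal_bundle_subgroup (E B P F : topologicalType) (a : G -> E -> E)
    (pE : E -> B) (pi : G -> P) (p : E -> F) (H : set G) :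
  continuous_action mul one a ->
  principal_bundle [set: G] a pE ->
  (forall g h, pi g = pi h <-> exists k, H k /\ h = mul g k) ->
  principal_bundle H (fun k g => mul g k) pi ->
  (forall k, H k -> H (inv k)) ->
  quotient_map p ->
  (forall e e', p e = p e' <-> exists2 k, H k & a k e = e') ->
  principal_bundle H a p.
Proof.
move=> CA [cpE pEa locE] piP [cpi _ locP] Hinv qp pP.
apply: principal_bundle_of_equivariant => // e0.
have [U [s [oU Ub _ sK [j [_ jU jK Kj [_ cj]]]]]] := locE (pE e0).
have oU' : open (pE @^-1` U) by apply: open_comp => // ? _; exact: cpE.
move/(within_open_continuousP _ oU'): cj => cj.
pose h e := (j e).2.
have [V [sg [oV Vb csg sgK _]]] := locP (pi (inv (h e0))).
move/(within_open_continuousP _ oV): csg => csg.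
have h_act k e : U (pE e) -> h (a k e) = mul k (h e).
  move=> Ue; have [Uj _] := jU _ Ue.
  rewrite -{1}(Kj _ Ue) -(actionM CA) /h.
  by rewrite (jK ((j e).1, mul k (j e).2)).
have ch e : U (pE e) -> {for e, continuous (fun e => pi (inv (h e)))}.
  move=> Ue; apply: continuous_at_comp; last exact: cpi.
  apply: continuous_at_comp; last exact: group_inv_continuous.
  by apply: continuous_at_snd; exact: cj.
(* Inversion turns left translation of [h e] by [H] into right translation, which [pi] does not
   see. *)
have pi_h k e : H k -> U (pE e) -> pi (inv (h (a k e))) = pi (inv (h e)).
  move=> Hk Ue; rewrite h_act // group_invM; apply/esym/piP.
  by exists (inv k); split=> //; exact: Hinv.
exists ((pE @^-1` U) `&` (fun e => pi (inv (h e))) @^-1` V).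
exists (fun e => mul (h e) (sg (pi (inv (h e))))); split.
- exact: open_preimage_on.
- by [].
- move=> k e Hk [Ue Ve]; split=> /=; first by rewrite pEa.
  by rewrite pi_h.
- move=> e [Ue Ve]; split.
    have /esym/piP [k [Hk ->]] := sgK _ Ve.
    by rewrite group_mulVKg.
  apply: continuous_at2; first exact: group_mul_continuous.
    by apply: continuous_at_snd; exact: cj.
  by apply: continuous_at_comp; [exact: ch|exact: csg].
- by move=> k e Hk [Ue Ve]; rewrite pi_h // h_act // group_mulA.
Qed.

End GroupActions.

(** * Local triviality of the comparison map *)

(* Fix Gam = Stab x0 and represent each b by y with Stab y = Gam.  Over a local
   section sigma of q through y with constant stabilizer Gam, the class of
   (e, g sigma(b)) goes to (b, Gam g^-1 e). *)
Lemma comparison_map_fibre_bundle (G X Q EG XhG F : topologicalType)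
    (mul : G -> G -> G) (inv : G -> G) (one : G)
    (act : G -> X -> X) (q : X -> Q) (aE : G -> EG -> EG)
    (r : EG * X -> XhG) (c : XhG -> Q) (Gam : set G) (p : EG -> F) :
  topological_group mul inv one ->
  continuous_action mul one act ->
  orbit_space act q ->
  continuous_action mul one aE ->
  orbit_space (fun (g : G) (ex : EG * X) => (aE g ex.1, act g ex.2)) r ->
  (forall e x, c (r (e, x)) = q x) ->
  (forall x, exists S : set X, S x /\ constant_slice mul one act S (Stab act x)) ->
  (forall b, exists2 y, q y = b & Stab act y = Gam) ->
  quotient_map p ->
  (forall e e', p e = p e' <-> exists2 k, Gam k & aE k e = e') ->
  principal_bundle Gam aE p ->
  fibre_bundle c F.
Proof.
move=> TG CA OS CE OR cr slices rep qp pP [_ _ locp].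
have qr := orbit_quotient_map OR.
have cq := quotient_map_continuous (orbit_quotient_map OS).
have cp := quotient_map_continuous qp.
have cc : continuous c.
  move=> z; apply: (quotient_map_descent qr openT) => // -[e x] _.
  apply: (@near_eq_continuous _ _ (fun ex => q ex.2)).
    by apply: filterE => -[e' x']; rewrite cr.
  by apply: continuous_at_comp; [exact: cvg_snd|exact: cq].
split=> // b.
(* A representative with stabilizer equal, not just conjugate, to [Gam] gives the same fibre [F]
   over every b. *)
have [y qy Sty] := rep b.
have [S [Sy sl]] := slices y.
have [W [sigma [oW Wb sigmaP thetaP]]] := constant_slice_section TG CA OS Sy sl.
rewrite {}qy {}Sty in Wb sigmaP.
have rE e x g : r (aE g e, act g x) = r (e, x).
  by apply/esym/(orbit_eqP OR); exists g.
(* A group element identifying the two pairs fixes sigma(b'), hence lies in [Gam]. *)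
have p_uniq e e' b' : W b' -> r (e, sigma b') = r (e', sigma b') -> p e = p e'.
  move=> Wb' /(orbit_eqP OR) [k [ke ks]]; apply/pP; exists k => //.
  by have [_ _ <-] := sigmaP _ Wb'.
(* If x = theta(x) sigma(q x), the class of (e, x) is that of (theta(x)^-1 e, sigma(q x)). *)
have /choice [lift liftP] :
    forall z, exists e, W (c z) -> r (e, sigma (c z)) = z.
  move=> z; have [[e x] <-] := qr.1 z; rewrite cr.
  have [Wx|nWx] := pselect (W (q x)); last by exists e.
  have [theta [_ /nbhs_singleton thx]] := thetaP _ Wx.
  by exists (aE (inv (theta x)) e) => _; rewrite -(rE _ _ (theta x)) (actionVK TG CE) thx.
have /choice [sp spK] := qp.1.
have cW : open (c @^-1` W) by apply: open_comp => // ? _; exact: cc.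
(* [lift] and [sp] are arbitrary choices; over [W], [p_uniq] and [psiE] remove the dependence on
   them. *)
pose phi z := (c z, p (lift z)).
pose psi (bf : Q * F) := r (sp bf.2, sigma bf.1).
have psiE b' e : W b' -> psi (b', p e) = r (e, sigma b').
  move=> Wb'; have /pP [k Hk ke] := spK (p e).
  rewrite /psi /= -(rE _ _ k) ke; congr (r (_, _)).
  by have [_ _ Hs] := sigmaP _ Wb'; move: Hk; rewrite -Hs.
have c_psi b' f : W b' -> c (psi (b', f)) = b'.
  by move=> Wb'; rewrite /psi cr; case: (sigmaP _ Wb').
have cphi z : W (c z) -> {for z, continuous phi}.
  apply: (quotient_map_descent qr cW) => -[e x] /= Wc.
  have Wx : W (q x) by rewrite -(cr e).
  have [theta [ctheta near_theta]] := thetaP _ Wx.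
  (* Pulled back along [r], [phi] is expressed through the locally continuous [theta] instead of
     [lift]. *)
  apply: (@near_eq_continuous _ _
            (fun ex => (q ex.2, p (aE (inv (theta ex.2)) ex.1)))).
    have near1 : \forall ex \near (e, x), act (theta ex.2) (sigma (q ex.2)) = ex.2.
      exact: (@cvg_snd _ _ (nbhs e) (nbhs x) _ _ near_theta).
    have near2 : \forall ex \near (e, x), W (q ex.2).
      apply: (@open_preimage_near _ _ (fun ex : EG * X => q ex.2)) => //.
      by apply: continuous_at_comp; [exact: cvg_snd|exact: cq].
    apply: filterS2 near1 near2 => -[e' x'] /= th Wx'.
    rewrite /phi cr; congr (_, _).
    apply: (p_uniq _ _ _ Wx').
    have := liftP (r (e', x')); rewrite cr => /(_ Wx') ->.
    by rewrite -(rE _ _ (theta x')) (actionVK TG CE) th.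
  apply: continuous_at_pair.
    by apply: continuous_at_comp; [exact: cvg_snd|exact: cq].
  apply: continuous_at_comp; last exact: cp.
  apply: continuous_at2; [exact: (action_continuous CE)| |exact: cvg_fst].
  apply: continuous_at_comp; last exact: (group_inv_continuous TG).
  by apply: continuous_at_comp; [exact: cvg_snd|].
have cpsi bf : W bf.1 -> {for bf, continuous psi}.
  move: bf => [b0 f0] /= Wb0.
  have [U [s [oU Uf /(within_open_continuousP _ oU) cs sK _]]] := locp f0.
  (* By [psiE], the discontinuous choice [sp] may be replaced by a continuous local section of
     [p]. *)
  apply: (@near_eq_continuous _ _ (fun bf => r (s bf.2, sigma bf.1))).
    have near1 : \forall bf \near (b0, f0), W bf.1.
      by apply: (@open_preimage_near _ _ fst) => //; exact: cvg_fst.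
    have near2 : \forall bf \near (b0, f0), U bf.2.
      by apply: (@open_preimage_near _ _ snd) => //; exact: cvg_snd.
    apply: filterS2 near1 near2 => -[b' f'] /= Wb' Uf'.
    by rewrite -psiE // sK.
  apply: continuous_at_comp; last exact: (quotient_map_continuous qr).
  apply: continuous_at_pair.
    by apply: continuous_at_comp; [exact: cvg_snd|exact: cs].
  by apply: continuous_at_comp; [exact: cvg_fst|case: (sigmaP _ Wb0)].
exists W, phi; split=> //.
exists psi; split.
- by move=> z Wz; split.
- by move=> [b' f] [/= Wb' _]; rewrite c_psi.
- move=> z Wz; rewrite /phi psiE //; exact: liftP.
- move=> [b' f] [/= Wb' _]; rewrite /phi c_psi //; congr (_, _).
  rewrite -[RHS]spK; apply: (p_uniq _ _ _ Wb').
  by have := liftP (psi (b', f)); rewrite c_psi // => ->.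
split; first exact/within_open_continuousP.
apply/within_open_continuousP; first exact: open_setXT.
by move=> bf [Wb' _]; exact: cpsi.
Qed.

(** * Conjugacy of stabilizers *)

(** The orbits containing a point with stabilizer exactly [Stab act x] form a nonempty set, open and
    closed because stabilizers are constant along local sections. *)
Lemma stabilizers_conjugate (G X Q : topologicalType)
    (mul : G -> G -> G) (inv : G -> G) (one : G)
    (act : G -> X -> X) (q : X -> Q) (x : X) :
  topological_group mul inv one ->
  continuous_action mul one act ->
  orbit_space act q ->
  connected [set: Q] ->
  (forall x, exists S : set X, S x /\ constant_slice mul one act S (Stab act x)) ->
  forall b, exists2 y, q y = b & Stab act y = Stab act x.
Proof.
move=> TG CA OS conn slices.
pose C := [set b | exists2 y, q y = b & Stab act y = Stab act x].
(* The stabilizer of g z depends only on g and that of z, so the g that works for y works for z. *)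
have transfer y z : Stab act y = Stab act z -> C (q y) -> C (q z).
  move=> yz [y' /esym/(orbit_eqP OS) [g gy] Sy'].
  exists (act g z); first exact: (orbit_map_act OS).
  by rewrite (Stab_act TG CA) -yz -(Stab_act TG CA) gy.
have loc y : exists W : set Q, [/\ open W, W (q y) &
    forall b, W b -> exists2 z, q z = b & Stab act z = Stab act y].
  have [S [Sy sl]] := slices y.
  have [W [sigma [oW Wy sigmaP _]]] := constant_slice_section TG CA OS Sy sl.
  exists W; split=> // b /sigmaP [qs _ Ss]; by exists (sigma b).
have [qsurj _] := orbit_quotient_map OS.
have oC : open C.
  rewrite openE => b; have [y <-] := qsurj b => Cb.
  have [W [oW Wy WP]] := loc y.
  apply: filterS (open_nbhs_nbhs (conj oW Wy)) => _ /WP [z <- zy].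
  exact: transfer Cb.
have oC' : open (~` C).
  rewrite openE => b; have [y <-] := qsurj b => nCb.
  have [W [oW Wy WP]] := loc y.
  apply: filterS (open_nbhs_nbhs (conj oW Wy)) => _ /WP [z <- zy] Cz.
  by apply: nCb; exact: transfer Cz.
have CT : C = [set: Q].
  apply: conn; first by exists (q x), x.
    by exists C; rewrite ?setTI.
  by exists C; rewrite ?setTI // -openC.
by move=> b; have : [set: Q] b by []; rewrite -CT.
Qed.

(** * Conjugacy and the fibre EG/Gam *)

Theorem theorem3p4
  (G X Q EG BG XhG : topologicalType)
  (mul : G -> G -> G) (inv : G -> G) (one : G)
  (act : G -> X -> X) (q : X -> Q)
  (aE : G -> EG -> EG) (pE : EG -> BG)
  (r : EG * X -> XhG) (c : XhG -> Q) :
  topological_group mul inv one ->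
  continuous_action mul one act ->
  orbit_space act q ->
  connected [set: Q] ->
  (forall x, exists S : set X, S x /\ constant_slice mul one act S (Stab act x)) ->
  (* EG -> BG: the universal principal G-bundle *)
  continuous_action mul one aE ->
  orbit_space aE pE ->
  principal_bundle [set: G] aE pE ->
  contractible EG ->
  (* XhG = X//G = (EG x X)/G for the diagonal action *)
  orbit_space (fun (g : G) (ex : EG * X) => (aE g ex.1, act g ex.2)) r ->
  (* c : X//G -> X/G is the comparison map induced by projection to X *)
  (forall e x, c (r (e, x)) = q x) ->
  (forall x y : X, exists g : G,
      Stab act y = [set mul (mul g h) (inv g) | h in Stab act x]) /\
  (forall x : X, exists F : topologicalType,
      fibre_bundle c F /\ classifying_space mul one (Stab act x) F).
Proof.
move=> TG CA OS conn slices CE _ PE ctr OR cr.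
have rep x := @stabilizers_conjugate _ _ _ _ _ _ _ _ x TG CA OS conn slices.
split=> [x y|x].
  have [y' /(orbit_eqP OS) [g <-] Sy'] := rep x (q y).
  by exists g; rewrite (Stab_act TG CA) Sy'.
have Sinv := @Stab_inv _ _ _ _ TG _ _ CA x.
have [F [p [qp pP]]] :
    exists (F : topologicalType) (p : EG -> F), quotient_map p /\
      forall e e', p e = p e' <-> exists2 k, Stab act x k & aE k e = e'.
  apply: quotient_by_equivalence.
  - by move=> e; exists one; [exact: (Stab_one CA)|exact: (action1 CE)].
  - move=> e e' [k Sk <-]; exists (inv k); first exact: Sinv.
    exact: (actionK TG CE).
  - move=> e e' e'' [k Sk <-] [l Sl <-]; exists (mul l k).
      exact: (Stab_mul CA).
    exact: (actionM CE).
have pb : principal_bundle (Stab act x) aE p.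
  (* SL3 for a slice at x supplies the principal bundle G -> G/Gam. *)
  have [S [_ [[_ _ [P [pi [_ piP _ pbpi _]]]] _]]] := slices x.
  exact: (principal_bundle_subgroup TG CE PE piP pbpi).
exists F; split.
  exact: (comparison_map_fibre_bundle TG CA OS CE OR cr slices (rep x) qp pP pb).
exists EG, aE, p; split=> //.
- exact: (action1 CE).
- by move=> g h e _ _; exact: (actionM CE).
- exact/continuous_subspaceT/(action_continuous CE).
Qed.
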